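(* Let $q$ be a prime power and let $C$ be a linear $[n,k,d]_q$ code with parity check matrix $H$ and generator matrix $G$. Then $\operatorname{rank}(HH^t)$ and $\operatorname{rank}(GG^t)$ are independent of the choice of $H$ and $G$, and $$\operatorname{rank}(HH^t)=n-k-\dim(\mathrm{Hull}(C))=n-k-\dim(\mathrm{Hull}(C^{\perp})),$$ $$\operatorname{rank}(GG^t)=k-\dim(\mathrm{Hull}(C))=k-\dim(\mathrm{Hull}(C^{\perp})).$$
   Context: $\mathbb{F}_q$ is the finite field with $q$ elements. An $[n,k,d]_q$ linear code is a $k$-dimensional subspace of $\mathbb{F}_q^n$ with minimum Hamming distance $d$. The Euclidean dual is $C^{\perp}=\{v\in\mathbb{F}_q^n : \sum_i v_iw_i=0 \text{ for all } w\in C\}$. A generator matrix of $C$ is a $k\times n$ matrix whose rows form a basis of $C$; a parity check matrix of $C$ is an $(n-k)\times n$ matrix whose rows form a basis of $C^{\perp}$. The Euclidean hull is $\mathrm{Hull}(C)=C\cap C^{\perp}$. $M^t$ denotes the transpose of $M$. *)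

(* Defs.v *)
From HB Require Import structures.
From mathcomp Require Import all_boot all_order all_algebra all_field.

Set Implicit Arguments.
Unset Strict Implicit.
Unset Printing Implicit Defensive.

Import GRing.Theory.

Local Open Scope ring_scope.

Section Codes.

Variables (F : finFieldType) (n : nat).
Implicit Types (v w : 'rV[F]_n) (C : {vspace 'rV[F]_n}).

Definition hamming_dist v w : nat := #|[set i | v 0 i != w 0 i]|.

(* The zero code has no two distinct codewords, so its minimum distance is
   left unconstrained: every d is accepted for it. *)
Definition min_distance C (d : nat) : Prop :=
  (forall v w, v \in C -> w \in C -> v != w -> (d <= hamming_dist v w)%N)
  /\ (C != 0%VS -> exists v w,
        [/\ v \in C, w \in C, v != w & hamming_dist v w = d]).

Definition linear_code (k d : nat) C : Prop :=
  \dim C = k /\ min_distance C d.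

Definition euclid_form w v : F^o := \sum_(i < n) v 0 i * w 0 i.

Fact euclid_form_is_linear w : linear (euclid_form w).
Proof.
move=> a u v; rewrite /euclid_form scaler_sumr -big_split /=.
by apply: eq_bigr => i _; rewrite !mxE mulrDl -mulrA.
Qed.

HB.instance Definition _ w :=
  GRing.isLinear.Build F 'rV[F]_n F^o *:%R (euclid_form w)
    (euclid_form_is_linear w).

Definition dual C : {vspace 'rV[F]_n} :=
  (\bigcap_(w : 'rV[F]_n | w \in C) lker (linfun (euclid_form w)))%VS.

Lemma dualP C v :
  reflect (forall w, w \in C -> \sum_(i < n) v 0 i * w 0 i = 0)
          (v \in dual C).
Proof.
rewrite memvE; apply: (iffP subv_bigcapP) => vC w /vC.
  by rewrite -memvE memv_ker lfunE => /eqP.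
by move=> vw0; rewrite -memvE memv_ker lfunE; apply/eqP.
Qed.

Definition hull C : {vspace 'rV[F]_n} := (C :&: dual C)%VS.

Definition rows_basis (m : nat) C (M : 'M[F]_(m, n)) : bool :=
  basis_of C [seq row i M | i <- enum 'I_m].

Definition generator_matrix (k : nat) C (G : 'M[F]_(k, n)) : bool :=
  rows_basis C G.

(* Only meaningful for k = \dim C, so that k <= n and n - k is not truncated. *)
Definition parity_check_matrix (k : nat) C (H : 'M[F]_(n - k, n)) : bool :=
  rows_basis (dual C) H.

End Codes.

(* Main.v *)
(* If the rows of M are a basis of C, then v lies in the dual of C iff v M^T = 0,
   so Hull(C) is the intersection of the row space of M with the kernel of M^T,
   and rank-nullity for M^T restricted to that row space gives
   rank(M M^T) + dim Hull(C) = dim C.  This applies to G and C, and to H and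
   C^perp; the hulls of C and C^perp agree because C^perp^perp = C. *)
Require Import Defs.
From mathcomp Require Import all_boot all_order all_algebra all_field.

Set Implicit Arguments.
Unset Strict Implicit.
Unset Printing Implicit Defensive.

Import GRing.Theory.

Local Open Scope ring_scope.

Section RowSpaces.

Variables (F : finFieldType) (n : nat).
Implicit Types (v : 'rV[F]_n) (C V : {vspace 'rV[F]_n}).

Lemma mem_span_rows m (M : 'M[F]_(m, n)) v :
  (v \in <<[seq row i M | i <- enum 'I_m]>>%VS) = (v <= M)%MS.
Proof.
apply/idP/idP => [|/submxP[u ->]].
  rewrite memvE => /subvP /(_ v (memv_line v)) /coord_span ->.
  apply: summx_sub => i _; apply: scalemx_sub.
  have : (i < size [seq row j M | j <- enum 'I_m])%N by rewrite size_map -cardE.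
  by move=> /(mem_nth 0)/mapP[j _ ->]; apply: row_sub.
rewrite mulmx_sum_row; apply: memv_suml => i _; apply: memvZ.
by apply: memv_span; apply: map_f; rewrite mem_enum.
Qed.

(** Multiplying a vanishing combination of the rows on the right by a right inverse of [M] returns
    its coefficients, so they are all zero. *)
Lemma free_rows m (M : 'M[F]_(m, n)) :
  row_free M -> free [seq row i M | i <- enum 'I_m].
Proof.
move=> /row_freeP[N MN1]; set X := map _ _.
have sX : size X = m by rewrite size_map size_enum_ord.
have XE (i : 'I_m) : X`_i = row i M.
  by rewrite (nth_map i) ?size_enum_ord // nth_ord_enum.
(* The cast lets [freeP] index coefficients by ['I_m], so that they form a row vector that can
   multiply [M]. *)
suff: free (tcast sX (in_tuple X)) by rewrite val_tcast.
apply/freeP => c c0 i; rewrite val_tcast /= in c0.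
have: (\row_j c j) *m M = 0.
  rewrite mulmx_sum_row -[RHS]c0; apply: eq_bigr => j _.
  by rewrite mxE XE.
move/(congr1 (mulmx^~ N)); rewrite -mulmxA MN1 mulmx1 mul0mx => /rowP/(_ i).
by rewrite !mxE.
Qed.

(** Bridge from subspace dimension to matrix rank. The rows of [M] may be dependent, so the basis is
    taken from [row_base M], which has the same row space and exactly [\rank M] independent rows. *)
Lemma dim_rowspace V m (M : 'M[F]_(m, n)) :
  (forall v, (v \in V) = (v <= M)%MS) -> \dim V = \rank M.
Proof.
move=> VM; have -> : V = <<[seq row i (row_base M) | i <- enum 'I__]>>%VS.
  by apply/vspaceP => v; rewrite VM mem_span_rows eq_row_base.
have /free_rows/eqnP -> := row_base_free M.
by rewrite size_map size_enum_ord.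
Qed.

Lemma mem_rows_basis m C (M : 'M[F]_(m, n)) v :
  rows_basis C M -> (v \in C) = (v <= M)%MS.
Proof. by move=> /andP[/eqP<- _]; rewrite mem_span_rows. Qed.

Lemma dim_rows_basis m C (M : 'M[F]_(m, n)) : rows_basis C M -> \dim C = m.
Proof. by move=> /andP[/eqP<- /eqnP->]; rewrite size_map size_enum_ord. Qed.

Lemma rank_rows_basis m C (M : 'M[F]_(m, n)) : rows_basis C M -> \rank M = m.
Proof.
move=> CM; rewrite -[RHS](dim_rows_basis CM); apply/esym/dim_rowspace => v.
exact: mem_rows_basis.
Qed.

Lemma mem_dual_rows m C (M : 'M[F]_(m, n)) v :
  rows_basis C M -> (v \in dual C) = (v <= kermx M^T)%MS.
Proof.
have dotE w : v *m w^T = (\sum_(i < n) v 0 i * w 0 i)%:M.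
  apply/rowP => i; rewrite !mxE ord1 eqxx mulr1n.
  by apply: eq_bigr => j _; rewrite mxE.
move=> CM; rewrite sub_kermx; apply/dualP/eqP => [vC | vM w].
  (* Entry [i] of [v *m M^T] is the pairing of [v] with row [i] of [M], a codeword. *)
  apply/rowP => i; rewrite mxE [RHS]mxE -[RHS](vC (row i M)).
    by apply: eq_bigr => j _; rewrite !mxE.
  by rewrite (mem_rows_basis _ CM) row_sub.
rewrite (mem_rows_basis _ CM) => /submxP[u wE].
(* With [w = u *m M], the pairing is [v *m M^T *m u^T], whose first product vanishes. *)
have := dotE w; rewrite wE trmx_mul mulmxA vM mul0mx => /rowP/(_ 0).
by rewrite !mxE eqxx mulr1n.
Qed.

Lemma dim_dual m C (M : 'M[F]_(m, n)) :
  rows_basis C M -> \dim (dual C) = (n - m)%N.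
Proof.
move=> CM; rewrite (@dim_rowspace _ _ (kermx M^T)) => [|v].
  by rewrite mxrank_ker mxrank_tr (rank_rows_basis CM).
exact: mem_dual_rows.
Qed.

Lemma rank_gram m C (M : 'M[F]_(m, n)) :
  rows_basis C M -> (\rank (M *m M^T) + \dim (hull C))%N = m.
Proof.
move=> CM; rewrite (@dim_rowspace _ _ (M :&: kermx M^T)%MS) => [|v].
  by rewrite mxrank_mul_ker (rank_rows_basis CM).
by rewrite sub_capmx memv_cap (mem_rows_basis v CM) (mem_dual_rows v CM).
Qed.

(** This is the symmetry of the bilinear form. *)
Lemma sub_dual_dual C : (C <= dual (dual C))%VS.
Proof.
apply/subvP => v vC; apply/dualP => w /dualP/(_ v vC) wv0.
by rewrite -[RHS]wv0; apply: eq_bigr => i _; rewrite mulrC.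
Qed.

End RowSpaces.

Theorem proposition3p1 (q p e : nat) (p_prime : prime p) (e_gt0 : (0 < e)%N)
    (q_def : q = (p ^ e)%N) (F : finFieldType) (cardF : #|F| = q)
    (n k d : nat) (C : {vspace 'rV[F]_n}) (codeC : linear_code k d C)
    (H : 'M[F]_(n - k, n)) (parityH : parity_check_matrix C H)
    (G : 'M[F]_(k, n)) (genG : generator_matrix C G) :
  [/\ forall H' : 'M[F]_(n - k, n), parity_check_matrix C H' ->
        \rank (H' *m H'^T) = \rank (H *m H^T),
      forall G' : 'M[F]_(k, n), generator_matrix C G' ->
        \rank (G' *m G'^T) = \rank (G *m G^T),
      (\rank (H *m H^T))%:Z = n%:Z - k%:Z - (\dim (hull C))%:Z
        /\ n%:Z - k%:Z - (\dim (hull C))%:Z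
           = n%:Z - k%:Z - (\dim (hull (dual C)))%:Z
    & (\rank (G *m G^T))%:Z = k%:Z - (\dim (hull C))%:Z
        /\ k%:Z - (\dim (hull C))%:Z = k%:Z - (\dim (hull (dual C)))%:Z].
Proof.
have dimC : \dim C = k by case: codeC.
have le_kn : (k <= n)%N by rewrite -(rank_rows_basis genG) rank_leq_col.
have dualK : dual (dual C) = C.
  (* The inclusion is an equality by dimension: [n - (n - k)] is [k] because [k <= n]. *)
  apply/esym/eqP; rewrite eqEdim sub_dual_dual /= (dim_dual parityH) dimC.
  by rewrite subKn.
have hull_dual : hull (dual C) = hull C by rewrite /hull dualK capvC.
have rankH (H' : 'M_(n - k, n)) : parity_check_matrix C H' ->
    (\rank (H' *m H'^T) + \dim (hull C))%N = (n - k)%N.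
  by move=> /rank_gram; rewrite hull_dual.
rewrite hull_dual; split.
(* Adding the hull dimension gives [n - k] for either matrix, so the ranks agree by cancellation. *)
- move=> H' parityH'; apply: (@addIn (\dim (hull C))).
  by rewrite (rankH H') // (rankH H).
- move=> G' genG'; apply: (@addIn (\dim (hull C))).
  by rewrite (rank_gram genG') (rank_gram genG).
(* Since [k <= n], the integer difference is the image of the natural-number one. *)
- split=> //; apply/esym/eqP; rewrite subr_eq subzn //.
  by rewrite -PoszD (rankH H parityH).
- split=> //; apply/esym/eqP; rewrite subr_eq.
  by rewrite -PoszD (rank_gram genG).
Qed.
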